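(* Let $n\ge 3$ be an integer with $n\not\equiv 2\pmod 4$, let $k$ be a field, let $R=k[x_1,\ldots,x_n]$, and let $L_n$ be the line graph on $\{x_1,\ldots,x_n\}$. Then $$\operatorname{ara}(I_3(L_n))=\operatorname{pd}(R/I_3(L_n)).$$
   Context: The line graph $L_n$ is the directed tree with vertex set $\{x_1,\ldots,x_n\}$ and directed edges $(x_j,x_{j+1})$, $j=1,\ldots,n-1$. Its path ideal of length $t$ (length counts vertices) is $I_t(L_n)=(x_ix_{i+1}\cdots x_{i+t-1}:1\le i\le n-t+1)\subseteq R$; here $t=3$. $\operatorname{pd}$ denotes projective dimension over $R$. The arithmetical rank of an ideal $I\subseteq R$ is $$\operatorname{ara}(I)=\min\{s : \text{there exist }f_1,\ldots,f_s\in R\text{ with }\sqrt I=\sqrt{(f_1,\ldots,f_s)}\}.$$ *)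

(* Defs.v *)
From HB Require Import structures.
From mathcomp Require Import all_boot all_order all_algebra.
From mathcomp Require Import mpoly.
From mathcomp Require Import boolp classical_sets.

Set Implicit Arguments.
Unset Strict Implicit.
Unset Printing Implicit Defensive.

Import GRing.Theory.
Local Open Scope ring_scope.
Local Open Scope quotient_scope.
Local Open Scope classical_set_scope.

Definition is_minimum (P : nat -> Prop) (m : nat) : Prop :=
  P m /\ forall s : nat, P s -> (m <= s)%N.

(* The library provides quotients by subgroups only, as abelian groups. Here
   V / W is given its module structure when W is a submodule. The copy
   submod_pred of W records the closure under opposites, which submodClosed does
   not include as it also covers semimodules. *)
Section QuotientModule.
Variables (R : pzRingType) (V : lmodType R) (W : submodClosed V).

Definition submod_pred (x : V) : bool := x \in W.

Lemma submod_pred_zmod : zmod_closed submod_pred.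
Proof.
split=> [|x y Wx Wy]; first exact: rpred0.
by rewrite /in_mem /= /submod_pred -scaleN1r rpredD // rpredZ.
Qed.

HB.instance Definition _ :=
  GRing.isZmodClosed.Build V submod_pred submod_pred_zmod.

Definition submod_quot : Type :=
  Quotient.quot (GRing.ZmodClosed.clone V submod_pred _).
Local Notation Q := submod_quot.

HB.instance Definition _ := GRing.Zmodule.on Q.
HB.instance Definition _ := EqQuotient.on Q.

Definition quot_scale (a : R) : Q -> Q := lift_op1 Q ( *:%R a).

Lemma pi_quot_scale (a : R) (x : V) :
  quot_scale a (\pi_Q x) = \pi_Q (a *: x).
Proof.
have subZ z : z \in submod_pred -> a *: z \in submod_pred.
  exact: (@rpredZ R V W a z).
apply/eqP; rewrite eq_sym /quot_scale; unlock.
rewrite -Quotient.idealrBE -scalerBr subZ //.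
by rewrite Quotient.idealrBE reprK.
Qed.

Lemma quot_scalerA (a b : R) (x : Q) :
  quot_scale a (quot_scale b x) = quot_scale (a * b) x.
Proof. by rewrite -[x]reprK !pi_quot_scale scalerA. Qed.

Lemma quot_scale1r : left_id 1 quot_scale.
Proof. by move=> x; rewrite -[x]reprK pi_quot_scale scale1r. Qed.

Lemma quot_piD (x y : V) : \pi_Q (x + y) = \pi_Q x + \pi_Q y.
Proof.
exact: (raddfD
  (\pi_(Quotient.quot (GRing.ZmodClosed.clone V submod_pred _)))).
Qed.

Lemma quot_scalerDr : right_distributive quot_scale +%R.
Proof.
move=> a x y; rewrite -[x]reprK -[y]reprK -quot_piD !pi_quot_scale.
by rewrite scalerDr quot_piD.
Qed.

Lemma quot_scalerDl (x : Q) : {morph quot_scale^~ x : a b / a + b}.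
Proof.
by move=> a b; rewrite -[x]reprK !pi_quot_scale scalerDl quot_piD.
Qed.

HB.instance Definition _ := GRing.Zmodule_isLmodule.Build R Q
  quot_scalerA quot_scale1r quot_scalerDr quot_scalerDl.

End QuotientModule.

(* Ideals of R are the submodules of R^o, i.e. of R as a module over itself. *)
Notation ideal R := (submodClosed R^o).

Section Ideals.
Variable R : comNzRingType.

Definition in_ideal_gen (m : nat) (f : 'I_m -> R) (x : R^o) : bool :=
  `[< exists c : 'I_m -> R, x = \sum_(i < m) c i * f i >].

Lemma ideal_gen_submod (m : nat) (f : 'I_m -> R) :
  submod_closed (in_ideal_gen f).
Proof.
split.
  by apply/asboolP; exists (fun=> 0); rewrite big1 // => i _; rewrite mul0r.
move=> a _ _ /asboolP[c ->] /asboolP[d ->]; apply/asboolP.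
exists (fun i => a * c i + d i).
rewrite [a *: _]mulr_sumr -big_split /=.
by apply: eq_bigr => i _; rewrite mulrDl mulrA.
Qed.

HB.instance Definition _ (m : nat) (f : 'I_m -> R) :=
  GRing.isSubmodClosed.Build R R^o (in_ideal_gen f) (ideal_gen_submod f).

Definition ideal_gen (m : nat) (f : 'I_m -> R) : ideal R :=
  GRing.SubmodClosed.clone _ _ (in_ideal_gen f) _.

Definition radical (I : ideal R) : set R :=
  [set x | exists m : nat, x ^+ m \in I].

Definition is_ara (I : ideal R) : nat -> Prop :=
  is_minimum (fun s => exists f : 'I_s -> R, radical I = radical (ideal_gen f)).

Definition quotient_module (I : ideal R) : lmodType R := submod_quot I.

End Ideals.

Section ProjectiveDimension.
Variable R : pzRingType.

Definition projective (P : lmodType R) : Prop :=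
  forall (A B : lmodType R) (g : {linear A -> B}) (h : {linear P -> B}),
    (forall b : B, exists a : A, g a = b) ->
    exists l : {linear P -> A}, forall x : P, g (l x) = h x.

Record projective_resolution (M : lmodType R) := ProjectiveResolution {
  res_mod : nat -> lmodType R;
  res_diff : forall i : nat, {linear res_mod i.+1 -> res_mod i};
  res_aug : {linear res_mod 0%N -> M};
  res_projective : forall i : nat, projective (res_mod i);
  res_aug_surj : forall y : M, exists x, res_aug x = y;
  res_exact0 : forall x : res_mod 0%N,
    res_aug x = 0 <-> exists z, res_diff 0%N z = x;
  res_exact : forall (i : nat) (x : res_mod i.+1),
    res_diff i x = 0 <-> exists z, res_diff i.+1 z = x }.

Definition resolution_length_le (M : lmodType R)
    (P : projective_resolution M) (m : nat) : Prop :=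
  forall i : nat, (m < i)%N -> forall x : res_mod P i, x = 0.

(* The zero module is assigned dimension 0 (rather than -oo); a module without
   finite projective resolution has no projective dimension here. *)
Definition is_pd (M : lmodType R) : nat -> Prop :=
  is_minimum (fun m => exists P : projective_resolution M,
    resolution_length_le P m).

End ProjectiveDimension.

(* I_t(L_n). With variables 'X_0, ..., 'X_(n-1), the generators are
   'X_i * 'X_(i+1) * ... * 'X_(i+t-1) for 0 <= i < n - t + 1. *)
Definition path_ideal_gen (k : fieldType) (n t : nat) (i : 'I_(n.+1 - t)) :
    {mpoly k[n]} :=
  \prod_(j < n | (i <= j < i + t)%N) 'X_j.

Definition path_ideal_line (k : fieldType) (n t : nat) : ideal {mpoly k[n]} :=
  ideal_gen (@path_ideal_gen k n t).

(* Main.v *)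
Require Import Defs.
From HB Require Import structures.
From mathcomp Require Import all_boot all_order all_algebra.
From mathcomp Require Import mpoly freeg.
From mathcomp Require Import boolp.
From mathcomp Require Import zify ring.

(* Both invariants equal d = floor(n/2). Write J_j for the path ideal on the first
   j variables and g_i = X_i X_(i+1) X_(i+2).
   pd <= d: the colon ideal (J_(j-1) : g_(j-3)) is J_(j-4) + (X_(j-4)), and the
   resulting short exact sequences bound pd (R/J_j) by induction on j.
   ara <= d: the sums g_(2j-2) + g_(2j+1), suitably truncated, generate I up to
   radical, since the product of the two terms is a multiple of g_(2j-1).
   Both lower bounds come from a minimal prime P of I generated by d variables.
   The product u of the other variables has annihilator P modulo I, and a nonzero
   element killed by d variables forces pd >= d. Setting the other variables to 1
   turns generators of I up to radical into generators of an ideal primary to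
   the irrelevant ideal of a polynomial ring in d variables, so at least d are
   needed. *)

Set Implicit Arguments.
Unset Strict Implicit.
Unset Printing Implicit Defensive.

Import GRing.Theory.
Local Open Scope ring_scope.

(** * Linear maps: factorizations, kernels and cokernels *)

Section LinearConstructions.
Variable R : pzRingType.
Implicit Types U V W : lmodType R.

Lemma linear_ex U V (f : U -> V) :
  linear f -> exists g : {linear U -> V}, g =1 f.
Proof.
move=> fL; pose m := GRing.isLinear.Build R U V _ f fL.
by pose g : {linear U -> V} := HB.pack f m; exists g.
Qed.

Lemma factor_inj U V W (i : {linear U -> V}) (g : {linear W -> V}) :
    injective i -> (forall w, exists u, i u = g w) ->
  exists h : {linear W -> U}, forall w, i (h w) = g w.
Proof.
move=> i_inj img; have ex w : exists u, i u == g w.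
  by have [u iu] := img w; exists u; apply/eqP.
have hE w : i (xchoose (ex w)) = g w by apply/eqP/(xchooseP (ex w)).
have [|h hh] := @linear_ex W U (fun w => xchoose (ex w)).
  by move=> a x y; apply: i_inj; rewrite !(hE, linearP).
by exists h => w; rewrite hh hE.
Qed.

Lemma factor_surj U V W (p : {linear U -> V}) (g : {linear U -> W}) :
    (forall v, exists u, p u = v) -> (forall u, p u = 0 -> g u = 0) ->
  exists h : {linear V -> W}, forall u, h (p u) = g u.
Proof.
move=> p_surj kerp; have ex v : exists u, p u == v.
  by have [u pu] := p_surj v; exists u; apply/eqP.
have sE v : p (xchoose (ex v)) = v by apply/eqP/(xchooseP (ex v)).
have gE u u' : p u = p u' -> g u = g u'.
  move=> e; apply/eqP; rewrite -subr_eq0 -linearB; apply/eqP/kerp.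
  by rewrite linearB e subrr.
have [|h hh] := @linear_ex V W (fun v => g (xchoose (ex v))).
  by move=> a x y; rewrite -linearP; apply: gE; rewrite linearP !sE.
by exists h => u; rewrite hh; apply: gE; rewrite sE.
Qed.

Section Kernel.
Variables (U V : lmodType R) (f : {linear U -> V}).

Definition ker_pred : pred U := fun x => f x == 0.

Lemma ker_submod_closed : submod_closed ker_pred.
Proof.
split=> [|a x y /eqP fx /eqP fy]; first exact/eqP/linear0.
by apply/eqP; rewrite linearP fx fy scaler0 addr0.
Qed.

Lemma ker_oppr_closed : oppr_closed ker_pred.
Proof. by move=> x /eqP fx; apply/eqP; rewrite linearN fx oppr0. Qed.

HB.instance Definition _ := GRing.isSubmodClosed.Build R U ker_pred
  ker_submod_closed.
HB.instance Definition _ := GRing.isOppClosed.Build U ker_pred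
  ker_oppr_closed.

Record kernel : Type := Kernel { kernel_val :> U; _ : kernel_val \in ker_pred }.
HB.instance Definition _ := [isSub for kernel_val].
HB.instance Definition _ := [Choice of kernel by <:].
HB.instance Definition _ := [SubChoice_isSubZmodule of kernel by <:].
HB.instance Definition _ := [SubZmodule_isSubLmodule of kernel by <:].

End Kernel.

Lemma kernel_ex U V (f : {linear U -> V}) :
  exists (K : lmodType R) (i : {linear K -> U}),
    injective i /\ forall u, f u = 0 <-> exists z, i z = u.
Proof.
exists (kernel f : lmodType R), (\val : kernel f -> U); split.
  exact: val_inj.
move=> u; split=> [fu|[z <-]]; last exact/eqP/(valP z).
by have fu' : u \in ker_pred f by [exact/eqP]; exists (Kernel fu').
Qed.

Lemma cokernel_ex V (W : submodClosed V) :
  exists p : {linear V -> submod_quot W},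
    (forall y, exists x, p x = y) /\ (forall x, p x = 0 <-> x \in W).
Proof.
pose Q := submod_quot W; have [|p pE] := @linear_ex V Q (\pi_Q)%qT.
  by move=> a x y; rewrite quot_piD -pi_quot_scale.
exists p; split=> [y|x]; first by exists (repr y); rewrite pE reprK.
rewrite pE.
have -> : (0 : Q) = \pi_Q%qT 0 by rewrite -pE linear0.
split=> [/eqP|xW]; last apply/eqP; rewrite -Quotient.idealrBE subr0 //.
Qed.

End LinearConstructions.

(** * Projective dimension along short exact sequences *)

Section ProjectiveDimensionBound.
Variable R : pzRingType.
Implicit Types (A B M P Z : lmodType R) (C : lmodType R -> Prop).

Definition short_exact A B M (i : {linear A -> B}) (p : {linear B -> M}) :=
  [/\ injective i, forall y, exists x, p x = y
    & forall x, p x = 0 <-> exists z, i z = x].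

(* For C the class of projective modules this says pd M < m, with pd 0 = -oo. *)
Fixpoint pd_lt C (m : nat) M : Prop :=
  if m is m'.+1 then
    exists (P Z : lmodType R) (i : {linear Z -> P}) (p : {linear P -> M}),
      [/\ C P, short_exact i p & pd_lt C m' Z]
  else forall x : M, x = 0.

Lemma sub_pd_lt C C' m M :
  (forall P, C P -> C' P) -> pd_lt C m M -> pd_lt C' m M.
Proof.
move=> sCC'; elim: m M => //= m IH M [P [Z [i [p [CP ip Zm]]]]].
by exists P, Z, i, p; split; auto.
Qed.

Lemma projective_trivial M : (forall x : M, x = 0) -> projective M.
Proof.
move=> M0 A B g h _; exists (\0 : {linear M -> A}) => x.
by rewrite (M0 x) !linear0.
Qed.

Lemma projective_pair A B : projective A -> projective B ->
  projective (A * B)%type.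
Proof.
move=> PA PB U V g h gs.
have [|h1 h1E] := @linear_ex _ A V (fun a => h (a, 0)).
  by move=> c x y; rewrite -linearP; congr (h (_, _)); rewrite /= scaler0 addr0.
have [|h2 h2E] := @linear_ex _ B V (fun b => h (0, b)).
  by move=> c x y; rewrite -linearP; congr (h (_, _)); rewrite /= scaler0 addr0.
have [l1 l1E] := PA _ _ g h1 gs; have [l2 l2E] := PB _ _ g h2 gs.
have [|l lE] := @linear_ex _ (A * B)%type U (fun x => l1 x.1 + l2 x.2).
  move=> c x y; rewrite /= !linearP /= scalerDr.
  by rewrite !addrA; congr (_ + _); rewrite addrAC.
exists l => -[a b]; rewrite lE linearD l1E l2E h1E h2E -linearD.
by congr (h (_, _)); rewrite /= ?addr0 ?add0r.
Qed.

Lemma pd_lt0 m M : (forall x : M, x = 0) -> pd_lt (@projective R) m M.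
Proof.
elim: m M => [|m IH] M M0 //=.
exists M, M, (\0 : {linear M -> M}), (\0 : {linear M -> M}).
split; [exact: projective_trivial | | exact: IH].
split=> [x y _|y|x]; first by rewrite (M0 x) (M0 y).
  by exists 0; rewrite (M0 y).
by split=> // _; exists 0; rewrite (M0 x).
Qed.

Lemma pd_ltS m M : pd_lt (@projective R) m M -> pd_lt (@projective R) m.+1 M.
Proof.
elim: m M => [|m IH] M; first exact: pd_lt0.
by move=> [P [Z [i [p [PP ip /IH]]]]]; exists P, Z, i, p.
Qed.

Lemma pd_lt_le m m' M : (m <= m')%N ->
  pd_lt (@projective R) m M -> pd_lt (@projective R) m' M.
Proof.
move=> /subnK <-; elim: (m' - m)%N => // j IH Mm.
by rewrite addSn; apply: pd_ltS; apply: IH.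
Qed.

(** Horseshoe lemma: [B] is covered by the sum of the covers of [A] and [M], the latter lifted
    through [p]. The kernels of the three covers again form a short exact sequence, to which the
    induction applies. *)
Lemma horseshoe m A B M (i : {linear A -> B}) (p : {linear B -> M}) :
    short_exact i p ->
  pd_lt (@projective R) m A -> pd_lt (@projective R) m M ->
  pd_lt (@projective R) m B.
Proof.
elim: m A B M i p => [|m IH] A B M i p [i_inj p_surj ker_p].
  move=> A0 M0 x; have [z <-] := (ker_p x).1 (M0 _).
  by rewrite (A0 z) linear0.
move=> [P [Z [j [q [PP [j_inj q_surj ker_q] Zm]]]]].
move=> [P' [Z' [j' [q' [PP' [j'_inj q'_surj ker_q'] Zm']]]]].
have [l lE] := PP' _ _ p q' p_surj.
have [|r rE] := @linear_ex _ (P * P')%type B (fun x => i (q x.1) + l x.2).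
  move=> c x y; rewrite /= !linearP /= scalerDr.
  by rewrite !addrA; congr (_ + _); rewrite addrAC.
have [K [v [v_inj ker_r]]] := kernel_ex r.
have r0 x : r x = 0 -> q' x.2 = 0.
  rewrite rE => /(congr1 p); rewrite linearD linear0 lE => <-.
  by rewrite (ker_p (i (q x.1))).2 ?add0r //; exists (q x.1).
exists (P * P')%type, K, v, r; split; first exact: projective_pair.
  split=> // b; have [y yE] := q'_surj (p b).
  have [|a aE] := (ker_p (b - l y)).1; first by rewrite linearB lE yE subrr.
  by have [x xE] := q_surj a; exists (x, y); rewrite rE /= xE aE subrK.
have [|f fE] := @linear_ex _ Z (P * P')%type (fun z => (j z, 0)).
  by move=> c x y; congr (_, _); rewrite /= ?linearP // scaler0 addr0.
have [|f' f'E] := factor_inj (g := f) v_inj.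
  move=> z; apply/ker_r; rewrite rE fE /=.
  by rewrite (ker_q (j z)).2 ?linear0 ?addr0 //; exists z.
have [|s sE] := @linear_ex _ K P' (fun z => (v z).2).
  by move=> c x y; rewrite linearP.
have [|s' s'E] := factor_inj (g := s) j'_inj.
  by move=> z; apply/ker_q'; rewrite sE; apply: r0; apply/ker_r; exists z.
apply: (IH Z K Z' f' s') => //; split.
- by move=> x y e; apply: j_inj; have := f'E x; rewrite e f'E !fE => -[].
- move=> y; have y0 : q' (j' y) = 0 by apply/ker_q'; exists y.
  (* The lift of [j' y] to [B] dies in [M], hence comes from [A] and can be cancelled by an element
     of [P]. *)
  have [|a aE] := (ker_p (l (j' y))).1; first by rewrite lE.
  have [x xE] := q_surj (- a).
  have [|z zE] := (ker_r (x, j' y)).1.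
    by rewrite rE /= xE linearN aE addNr.
  by exists z; apply: j'_inj; rewrite s'E sE zE.
- move=> x; split=> [x0|[z zx]]; last first.
    by apply: j'_inj; rewrite s'E sE -zx f'E fE linear0.
  have v2 : (v x).2 = 0 by rewrite -sE -s'E x0 linear0.
  have : r (v x) = 0 by apply/ker_r; exists x.
  rewrite rE v2 linear0 addr0 -[0](linear0 i) => /i_inj /ker_q [z zE].
  by exists z; apply: v_inj; rewrite f'E fE zE -v2; case: (v x).
Qed.

(** A cover of [B] followed by [p] covers [M]. Its kernel [K] is an extension of [A] by the syzygy
    [Z] of [B], so [horseshoe] bounds it. *)
Lemma pd_lt_cokernel m A B M (i : {linear A -> B}) (p : {linear B -> M}) :
    short_exact i p ->
  pd_lt (@projective R) m A -> pd_lt (@projective R) m.+1 B ->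
  pd_lt (@projective R) m.+1 M.
Proof.
move=> [i_inj p_surj ker_p] Am [P [Z [j [q [PP [j_inj q_surj ker_q] Zm]]]]].
pose r : {linear P -> M} := p \o q.
have [K [v [v_inj ker_r]]] := kernel_ex r.
exists P, K, v, r; split=> //.
  split=> // y; have [b bE] := p_surj y; have [x xE] := q_surj b.
  by exists x; rewrite /r /= xE bE.
have [|f fE] := factor_inj (g := j) v_inj.
  move=> z; apply/ker_r; rewrite /r /= (ker_q (j z)).2 ?linear0 //.
  by exists z.
have [|s sE] := factor_inj (g := q \o v) i_inj.
  by move=> z; apply/ker_p/ker_r; exists z.
apply: (@horseshoe m Z K A f s) => //; split.
- by move=> x y e; apply: j_inj; rewrite -!fE e.
- move=> a; have [x xE] := q_surj (i a).
  have [|z zE] := (ker_r x).1.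
    by rewrite /r /= xE; apply/ker_p; exists a.
  by exists z; apply: i_inj; rewrite sE /= zE.
- move=> x; split=> [x0|[z <-]].
    have /ker_q [z zE] : q (v x) = 0 by have := sE x; rewrite x0 linear0.
    by exists z; apply: v_inj; rewrite fE.
  apply: i_inj; rewrite sE /= fE linear0.
  by apply/ker_q; exists z.
Qed.

Lemma pd_lt_resolution m M : pd_lt (@projective R) m M ->
  exists P : projective_resolution M,
    forall i, (m <= i)%N -> forall x : res_mod P i, x = 0.
Proof.
elim: m M => [|m IH] M /=.
  move=> M0; pose Z := (fun _ : nat => M); pose d := (\0 : {linear M -> M}).
  unshelve refine (ex_intro _
    (@ProjectiveResolution _ _ Z (fun=> d) d _ _ _ _) _).

  - by move=> i; apply: projective_trivial.
  - by move=> y; exists 0; rewrite (M0 y).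
  - by move=> x; split=> // _; exists 0; rewrite (M0 x).
  - by move=> i x; split=> // _; exists 0; rewrite (M0 x).
  - by [].
move=> [P [Z [i [p [PP [i_inj p_surj ker_p] /IH [Q Q0]]]]]].
(* Splicing: the resolution of [Z] is shifted up by one degree and joined to [P] by [i] after its
   augmentation. *)
pose T := (fun j : nat => if j is j'.+1 then res_mod Q j' else P).
pose d := (fun j => if j is j'.+1 return {linear T j.+1 -> T j}
                    then @res_diff _ _ Q j' else (i \o @res_aug _ _ Q)).
unshelve refine (ex_intro _ (@ProjectiveResolution _ _ T d p _ p_surj _ _) _).
- by case=> [//|j]; apply: (@res_projective _ _ Q).
- move=> x; split=> [/ker_p [z <-]|[z <-]].
    by have [y <-] := @res_aug_surj _ _ Q z; exists y.
  by apply/ker_p; exists (res_aug Q z).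
- case=> [|j] x; last exact: (@res_exact _ _ Q).
  rewrite /d /= -[0](linear0 i); split=> [/i_inj /res_exact0 //|e].
  by congr (i _); apply/res_exact0.
- by case=> // j; apply: Q0.
Qed.

Lemma resolution_pd_lt m M (P : projective_resolution M) :
  (forall i, (m <= i)%N -> forall x : res_mod P i, x = 0) ->
  pd_lt (@projective R) m M.
Proof.
elim: m M P => [|m IH] M P P0 /=.
  by move=> y; have [x <-] := res_aug_surj P y; rewrite (P0 0%N _ x) ?linear0.
have [K [v [v_inj ker_a]]] := kernel_ex (res_aug P).
exists (res_mod P 0%N), K, v, (res_aug P); split=> //.
- exact: res_projective.
- by split=> //; apply: res_aug_surj.
(* The first differential corestricts to an augmentation of the shifted resolution onto the kernel
   [K]. *)
have [|a aE] := factor_inj (g := res_diff P 0%N) v_inj.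
  by move=> z; apply/ker_a/res_exact0; exists z.
unshelve refine (IH _ (@ProjectiveResolution _ _ (fun i => res_mod P i.+1)
  (fun i => res_diff P i.+1) a _ _ _ _) _).
- by move=> i; apply: res_projective.
- move=> y.
  have /res_exact0 [z zE] : res_aug P (v y) = 0 by apply/ker_a; exists y.
  by exists z; apply: v_inj; rewrite aE.
- move=> x; split=> [ax|/(@res_exact _ _ P) e].
    by apply/(@res_exact _ _ P); rewrite -aE ax linear0.
  by apply: v_inj; rewrite aE e linear0.
- by move=> i x; apply: res_exact.
- by move=> i im; apply: (P0 i.+1).
Qed.

End ProjectiveDimensionBound.

(** * Division operators and the lower bound for projective dimension *)

Section DivisionOperators.
Variable R : comNzRingType.
Implicit Types (M P Q Z : lmodType R) (x : R) (xs : seq R).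

(* Implies that xs is a regular sequence on P, and unlike regularity it is
   visibly inherited by direct summands and by the quotients P / x P. *)
Definition div_ops xs P := forall c, c \in xs -> exists q : P -> P,
  [/\ forall f g, q (f + g) = q f + q g, forall f, q (c *: f) = f
    & forall b f, b \in xs -> b != c -> q (b *: f) = b *: q f].

Section ScaledImage.
Variables (M : lmodType R) (x : R).

Definition scale_image_pred : pred M := fun y => `[< exists z, y = x *: z >].

Lemma scale_image_closed : submod_closed scale_image_pred.
Proof.
split=> [|a u v /asboolP[y ->] /asboolP[z ->]]; apply/asboolP.
  by exists 0; rewrite scaler0.
by exists (a *: y + z); rewrite scalerDr !scalerA mulrC.
Qed.

HB.instance Definition _ :=
  GRing.isSubmodClosed.Build R M scale_image_pred scale_image_closed.

Lemma scale_quotient_ex : exists (Q : lmodType R) (p : {linear M -> Q}),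
  (forall y, exists z, p z = y) /\
  (forall y, p y = 0 <-> exists z, y = x *: z).
Proof.
have [p [p_surj ker_p]] :=
  cokernel_ex (GRing.SubmodClosed.clone R M scale_image_pred _).
exists (submod_quot (GRing.SubmodClosed.clone R M scale_image_pred _)), p.
by split=> // y; rewrite ker_p; split=> [/asboolP|?] //; apply/asboolP.
Qed.

End ScaledImage.

(** By [uniq], each [c] in [xs] differs from [x], so its operator commutes with [x], preserves the
    multiples of [x] and descends to the quotient. *)
Lemma div_ops_quotient x xs P Q (p : {linear P -> Q}) :
    (forall y, exists z, p z = y) ->
    (forall y, p y = 0 <-> exists z, y = x *: z) ->
  uniq (x :: xs) -> div_ops (x :: xs) P -> div_ops xs Q.
Proof.
move=> p_surj ker_p /= /andP[x_xs xs_uniq] dP c c_xs.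
have [|q [qD qK qC]] := dP c; first by rewrite inE c_xs orbT.
have [s sK] := choice p_surj.
have gE f : p (q (s (p f))) = p (q f).
  have /ker_p [z zE] : p (s (p f) - f) = 0 by rewrite linearB sK subrr.
  have /eqP := zE; rewrite subr_eq => /eqP ->; rewrite qD qC ?mem_head //.
    rewrite linearD (_ : p (x *: q z) = 0) ?add0r //.
    by apply/ker_p; exists (q z).
  by apply: contraNneq x_xs => ->.
exists (fun y => p (q (s y))); split=> [f g|f|b f b_xs bc].
- by rewrite -[f]sK -[g]sK -linearD !gE qD linearD.
- by rewrite -[f]sK -linearZ !gE qK.
- by rewrite -[f]sK -linearZ !gE qC ?linearZ // inE b_xs orbT.
Qed.

(** Change of rings: the sequence of [Z], [P] and [M] stays exact modulo [x] because [x] is regular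
    on [M]. On [Z] it is regular too, since [Z] embeds in [P]. *)
Lemma pd_lt_scale_quotient m x xs M Q (p : {linear M -> Q}) :
    (forall y, exists z, p z = y) ->
    (forall y, p y = 0 <-> exists z, y = x *: z) ->
    uniq (x :: xs) -> (forall e : M, x *: e = 0 -> e = 0) ->
  pd_lt (div_ops (x :: xs)) m M -> pd_lt (div_ops xs) m Q.
Proof.
move=> + + xs_uniq; elim: m M Q p => [|m IH] M Q p p_surj ker_p x_reg.
  by move=> M0 y; have [z <-] := p_surj y; rewrite (M0 z) linear0.
move=> [P [Z [i [r [dP [i_inj r_surj ker_r] Zm]]]]].
have [q [qD qK _]] := dP x (mem_head _ _).
have xP_inj (f g : P) : x *: f = x *: g -> f = g.
  by move=> e; rewrite -[f]qK e qK.
have [QP [pP [pP_surj ker_pP]]] := scale_quotient_ex P x.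
have [QZ [pZ [pZ_surj ker_pZ]]] := scale_quotient_ex Z x.
have [|i' i'E] := factor_surj (p := pZ) (g := pP \o i) pZ_surj.
  by move=> z /ker_pZ[y ->]; apply/ker_pP; exists (i y); rewrite linearZ.
have [|r' r'E] := factor_surj (p := pP) (g := p \o r) pP_surj.
  by move=> z /ker_pP[y ->]; apply/ker_p; exists (r y); rewrite linearZ.
exists QP, QZ, i', r'; split.
- exact: div_ops_quotient pP_surj ker_pP xs_uniq dP.
- split.
  + move=> y1 y2; have [z1 <-] := pZ_surj y1; have [z2 <-] := pZ_surj y2.
    move=> e; apply/eqP; rewrite -subr_eq0 -linearB; apply/eqP.
    have : pP (i (z1 - z2)) = 0.
      by move: e; rewrite !i'E /= !linearB => ->; rewrite subrr.
    move=> /ker_pP [f fE]; apply/ker_pZ.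
    (* Here regularity of [x] on [M] enters: [x *: r f] is zero because [x *: f] lies in the image
       of [Z]. *)
    have /ker_r [z zE] : r f = 0.
      by apply: x_reg; rewrite -linearZ -fE; apply/ker_r; exists (z1 - z2).
    by exists z; apply: i_inj; rewrite fE -zE linearZ.
  + move=> y; have [e <-] := p_surj y; have [f <-] := r_surj e.
    by exists (pP f); rewrite r'E.
  + move=> y; have [f <-] := pP_surj y; rewrite r'E /=.
    split=> [/ker_p [e]|[z]].
      have [f' <-] := r_surj e; rewrite -linearZ => /eqP.
      rewrite -subr_eq0 -linearB => /eqP /ker_r [z zE].
      exists (pZ z); rewrite i'E /= zE linearB (_ : pP (x *: f') = 0) ?subr0 //.
      by apply/ker_pP; exists f'.
    have [z' <-] := pZ_surj z; rewrite i'E /= => e.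
    have : pP (f - i z') = 0 by rewrite linearB e subrr.
    move=> /ker_pP [f' f'E].
    have -> : f = x *: f' + i z' by rewrite -f'E subrK.
    rewrite linearD linearZ (_ : r (i z') = 0) ?addr0.
      by apply/ker_p; exists (r f').
    by apply/ker_r; exists z'.
- apply: IH Zm => // z xz; apply: i_inj; apply: xP_inj.
  by rewrite linear0 scaler0 -linearZ xz linear0.
Qed.

(* An element e killed by the first x of xs lifts to p in the cover P of M, and
   x p lies in the syzygy Z; its class in Z / x Z is killed by the other xs. *)
Lemma pd_lt_socle m xs M (e : M) : uniq xs -> (m <= size xs)%N ->
    pd_lt (div_ops xs) m M -> (forall x, x \in xs -> x *: e = 0) ->
  e = 0.
Proof.
elim: xs m M e => [|x xs IH] [|m] M e xs_uniq m_xs //=.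
move=> [P [Z [i [r [dP [i_inj r_surj ker_r] Zm]]]]] xs_e.
have [q [qD qK _]] := dP x (mem_head _ _).
have xP_inj (f g : P) : x *: f = x *: g -> f = g.
  by move=> xfg; rewrite -[f]qK xfg qK.
have [f fe] := r_surj e.
have lift y : y \in x :: xs -> exists z, i z = y *: f.
  by move=> y_xs; apply/ker_r; rewrite linearZ fe; apply: xs_e.
have [z zE] := lift x (mem_head _ _).
have [Q [p [p_surj ker_p]]] := scale_quotient_ex Z x.
have /ker_p [w wE] : p z = 0.
  apply: (IH m Q); [by case/andP: xs_uniq|by []| |].
    apply: pd_lt_scale_quotient p_surj ker_p xs_uniq _ Zm => z' xz.
    apply: i_inj; apply: xP_inj.
    by rewrite linear0 scaler0 -linearZ xz linear0.
  move=> y y_xs; rewrite -linearZ; apply/ker_p.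
  have [|z' z'E] := lift y; first by rewrite inE y_xs orbT.
  by exists z'; apply: i_inj; rewrite !linearZ /= zE z'E !scalerA mulrC.
rewrite -fe; apply/ker_r; exists w; apply: xP_inj.
by rewrite -linearZ -wE.
Qed.

Definition free_module (K : choiceType) : lmodType R := {freeg K / R}.

Lemma coeff_scale (K : choiceType) a (f : free_module K) z :
  coeff z (a *: f) = a * coeff z f.
Proof. exact: (coeffZ a f z). Qed.

Lemma free_moduleP (K : choiceType) (f g : free_module K) :
  (forall z, coeff z f = coeff z g) -> f = g.
Proof. by move=> fg; apply/eqP/(@freeg_eqP R K). Qed.

Lemma div_ops_free (K : choiceType) (cs : seq R) :
  div_ops cs R^o -> div_ops cs (free_module K).
Proof.
move=> dR c /dR [q [qD qK qC]].
have q0 : q 0 = 0 by have := qK 0; rewrite scaler0.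
have mapE (f : {freeg K / R}) z : coeff z (fgmap xpredT q f) = q (coeff z f).
  by rewrite fgmap_f0_coeffE.
exists (fgmap xpredT q); split=> [f g|f|b f b_cs bc]; apply: free_moduleP => z.
- by rewrite [RHS]coeffD !mapE coeffD -qD.
- by rewrite mapE (coeff_scale c f z) [LHS]qK.
- rewrite mapE (coeff_scale b f z) (coeff_scale b _ z) mapE.
  exact: qC.
Qed.

(** [P] is a direct summand of the free module on its own elements. The operators act there
    coefficientwise and return to [P] through the splitting [l]. *)
Lemma projective_div_ops (cs : seq R) P :
  div_ops cs R^o -> projective P -> div_ops cs P.
Proof.
move=> dR PP; pose g : {additive {freeg P / R} -> P} := HB.pack (fglift (@id P))
  (GRing.isAdditive.Build {freeg P / R} P _ (lift_is_additive (@id P))).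
have gU a (x : P) : g << a *g x >> = a *: x by rewrite /g /= liftU.
have sD a (D E : {freeg P / R}) : a *: (D + E) = a *: D + a *: E.
  exact: scalerDr.
have gZU a b (x : P) : g (a *: << b *g x >>) = a *: g << b *g x >>.
  rewrite gU scalerA -gU; congr (g _).
  by apply/eqP/freeg_eqP => y; rewrite coeffZ !coeffU mulrA.
have gZ a (D : {freeg P / R}) : g (a *: D) = a *: g D.
  rewrite -[D]freeg_sumE; elim: (dom D) => [|x s IHs].
    by rewrite !big_nil scaler0 raddf0 scaler0.
  by rewrite !big_cons sD !raddfD IHs gZU.
have [|r rE] := @linear_ex _ (free_module P) P g.
  by move=> a D E; rewrite raddfD gZ.
have [|l lE] := PP (free_module P) P r idfun.
  by move=> x; exists << x >>; rewrite rE gU scale1r.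
move=> c /(@div_ops_free P _ dR) [q [qD qK qC]].
exists (fun x : P => r (q (l x))); split=> [x y|x|b x b_cs bc].
- by rewrite linearD qD linearD.
- by rewrite linearZ /= qK lE.
- by rewrite linearZ /= qC // linearZ.
Qed.

End DivisionOperators.

(** * Monomial ideals, their colons and their quotients *)

Section MonomialIdeals.
Variables (k : comNzRingType) (n : nat).
Local Notation S := {mpoly k[n]}.
Implicit Types (f g : S) (m mu : 'X_{1..n}).

(** Division by a monomial that drops the terms it does not divide. The degree bound only makes the
    sum finite: the coefficients beyond it vanish. *)
Definition mdivX mu f : S :=
  \sum_(m : 'X_{1..n < msize f}) f@_(mu + m) *: 'X_[m].

Lemma mcoeff_divX mu f m : (mdivX mu f)@_m = f@_(mu + m).
Proof.
rewrite /mdivX; case: (ltnP (mdeg m) (msize f)) => [|deg_m].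
  exact: (mcoeff_mpoly (fun m => f@_(mu + m))).
rewrite [RHS]memN_msupp_eq0; last first.
  by rewrite msize_mdeg_ge // mdegD (leq_trans deg_m) // leq_addl.
rewrite raddf_sum big1 // => -[m' /= deg_m'] _; rewrite mcoeffZ mcoeffX.
case: eqP => [e|_]; last by rewrite mulr0.
by move: deg_m'; rewrite e ltnNge deg_m.
Qed.

Lemma mcoeffXM mu f m : ('X_[mu] * f)@_(mu + m) = f@_m.
Proof. by rewrite mulrC mcoeffMX. Qed.

Lemma mcoeffXM_eq0 mu f m : ~~ (mu <= m)%MM -> ('X_[mu] * f)@_m = 0.
Proof.
move=> mu_m; apply: memN_msupp_eq0; apply: contra mu_m.
rewrite mulrC (perm_mem (msuppMX _ _)) => /mapP[m' _ ->].
by apply/mnm_lepP => i; rewrite mnmDE leq_addr.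
Qed.

Lemma mdivXK mu f : mdivX mu ('X_[mu] * f) = f.
Proof. by apply/mpolyP => m; rewrite mcoeff_divX mcoeffXM. Qed.

Lemma mdivXD mu f g : mdivX mu (f + g) = mdivX mu f + mdivX mu g.
Proof. by apply/mpolyP => m; rewrite mcoeffD !mcoeff_divX mcoeffD. Qed.

Lemma mdivXC (i j : 'I_n) f : i != j ->
  mdivX U_(i) ('X_j * f) = 'X_j * mdivX U_(i) f.
Proof.
move=> ij; apply/mpolyP => m; rewrite mcoeff_divX.
have [jm|jm] := boolP (U_(j) <= m)%MM; last first.
  rewrite !mcoeffXM_eq0 //.
  apply: contra jm => /mnm_lepP h; apply/mnm_lepP => l.
  have := h l; rewrite mnmDE !mnm1E; case: (eqVneq j l) => // <-.
  by rewrite (negbTE ij).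
have -> : m = (U_(j) + (m - U_(j)))%MM by rewrite addmC submK.
by rewrite addmA [(U_(i) + _)%MM]addmC -addmA !mcoeffXM mcoeff_divX.
Qed.

Lemma div_ops_vars (s : seq 'I_n) : div_ops [seq 'X_i : S | i <- s] S^o.
Proof.
move=> _ /mapP[i _ ->]; exists (mdivX U_(i)); split=> [f g|f|].
- exact: mdivXD.
- exact: mdivXK.
- move=> _ f /mapP[j _ ->] ij; apply: mdivXC.
  by apply: contra ij => /eqP ->.
Qed.

(** A monomial ideal is encoded by its set [D] of exponents, so that colons by monomials and sums
    become Boolean identities between such sets. *)
Definition monomials_in (D : pred 'X_{1..n}) f := all D (msupp f).

Lemma monomials_inP (D : pred 'X_{1..n}) f :
  reflect (forall m, ~~ D m -> f@_m = 0) (monomials_in D f).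
Proof.
apply: (iffP allP) => h m.
  by move=> Dm; apply: memN_msupp_eq0; apply: contra Dm => /h.
by rewrite mcoeff_msupp; apply: contraR => /h ->.
Qed.

Definition mnm_closed (D : pred 'X_{1..n}) := forall m m', D m -> D (m + m')%MM.

Lemma monomial_ideal_ex D : mnm_closed D ->
  exists W : ideal S, forall f, (f \in W) = monomials_in D f.
Proof.
move=> cD; have clW : submod_closed (monomials_in D : pred S^o).
  split=> [|a f g /allP Df /monomials_inP Dg].
    by apply/monomials_inP => m _; rewrite mcoeff0.
  apply/monomials_inP => m Dm; rewrite mcoeffD Dg // addr0.
  apply: memN_msupp_eq0; apply: contra Dm => /msuppM_le /allpairsP[[m1 m2]] /=.
  by move=> [_ /Df Dm2 ->]; rewrite addmC; apply: cD.
pose mix := GRing.isSubmodClosed.Build S S^o (monomials_in D) clW.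
by pose W : ideal S := HB.pack (monomials_in D : pred S^o) mix; exists W.
Qed.

Lemma monomials_in_colon D1 D2 mu f :
    (forall m, D2 (mu + m)%MM = D1 m) ->
  monomials_in D2 ('X_[mu] * f) = monomials_in D1 f.
Proof.
move=> D12; apply/monomials_inP/monomials_inP => h m Dm.
  by rewrite -(mcoeffXM mu) h // D12.
have [mum|mum] := boolP (mu <= m)%MM; last exact: mcoeffXM_eq0.
move: Dm; rewrite -(submK mum) addmC mcoeffXM D12 => /h; apply.
Qed.

Lemma monomials_in_add D2 D3 mu f :
    (forall m, D3 m = D2 m || (mu <= m)%MM) ->
  monomials_in D3 f <-> exists g, monomials_in D2 (f - 'X_[mu] * g).
Proof.
move=> D3E; split=> [/monomials_inP h|[g /monomials_inP h]].
  exists (mdivX mu f); apply/monomials_inP => m Dm.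
  rewrite mcoeffB; have [mum|mum] := boolP (mu <= m)%MM; last first.
    by rewrite mcoeffXM_eq0 // h ?subr0 // D3E (negbTE Dm).
  by rewrite -(submK mum) addmC mcoeffXM mcoeff_divX subrr.
apply/monomials_inP => m; rewrite D3E negb_or => /andP[Dm mum].
by have := h m Dm; rewrite mcoeffB mcoeffXM_eq0 ?subr0.
Qed.

Lemma pd_lt_free_quotient (W : ideal S) : (forall f, f \in W -> f = 0) ->
  pd_lt (@projective S) 1 (quotient_module W).
Proof.
move=> W0; have [p [p_surj ker_p]] := cokernel_ex W.
have [K [i [i_inj ker_i]]] := kernel_ex p.
exists (S^o : lmodType S), K, i, p; split=> //=.
  move=> A B g h g_surj; have [a ga] := g_surj (h 1).
  have [|l lE] := @linear_ex _ S^o A (fun x => x *: a).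
    by move=> c x y; rewrite scalerDl scalerA.
  by exists l => x; rewrite lE linearZ ga -linearZ /= [x *: _]mulr1.
move=> z; apply: i_inj; rewrite linear0; apply: W0; apply/ker_p/ker_i.
by exists z.
Qed.

(* The sequence 0 -> S/W1 -> S/W2 -> S/W3 -> 0 given by multiplication by a,
   where W1 = (W2 : a) and W3 = W2 + (a). *)
Lemma pd_lt_colon (m : nat) (W1 W2 W3 : ideal S) (a : S) :
    (forall f, (a * f \in W2) = (f \in W1)) ->
    (forall f, f \in W3 <-> exists g, f - a * g \in W2) ->
    pd_lt (@projective S) m (quotient_module W1) ->
    pd_lt (@projective S) m.+1 (quotient_module W2) ->
  pd_lt (@projective S) m.+1 (quotient_module W3).
Proof.
move=> W1E W3E.
have [p1 [p1_surj ker_p1]] := cokernel_ex W1.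
have [p2 [p2_surj ker_p2]] := cokernel_ex W2.
have [p3 [p3_surj ker_p3]] := cokernel_ex W3.
have mulaP (c : S) (x y : S^o) :
    (a * (c *: x + y) : S^o) = c *: (a * x : S^o) + (a * y : S^o).
  by rewrite mulrDr; congr (_ + _); apply: mulrCA.
have [|q qE] :=
  @linear_ex _ S^o (quotient_module W2) (fun x => p2 (a * x : S^o)).
  by move=> c x y; rewrite mulaP linearP.
have [|i iE] := factor_surj (p := p1) (g := q) p1_surj.
  by move=> x /ker_p1; rewrite qE -W1E => /ker_p2.
have [|p pE] := factor_surj (p := p2) (g := p3) p2_surj.
  by move=> x /ker_p2 x2; apply/ker_p3/W3E; exists 0; rewrite mulr0 subr0.
apply: (@pd_lt_cokernel _ m _ _ _ i p); split.
- move=> y1 y2; have [x1 <-] := p1_surj y1; have [x2 <-] := p1_surj y2.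
  move=> e; apply/eqP; rewrite -subr_eq0 -linearB; apply/eqP/ker_p1.
  rewrite -W1E; apply/ker_p2; rewrite -qE linearB -!iE e.
  by rewrite subrr.
- by move=> y; have [x <-] := p3_surj y; exists (p2 x).
- move=> y; have [x <-] := p2_surj y; rewrite pE.
  split=> [/ker_p3/W3E [g /ker_p2]|[z]].
    rewrite linearB => /eqP; rewrite subr_eq0 => /eqP ->.
    by exists (p1 g); rewrite iE qE.
  have [g <-] := p1_surj z; rewrite iE qE => e; apply/ker_p3/W3E.
  by exists g; apply/ker_p2; rewrite linearB e subrr.
Qed.

End MonomialIdeals.

(** * Exponents of the path ideals and the upper bound for projective dimension *)

Section PathIdeal.
Variables (k : fieldType) (n : nat).
Local Notation S := {mpoly k[n]}.
Implicit Types (f g : S) (m mu : 'X_{1..n}).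

(* Exponents indexed by nat, with junk value 0 outside the range. *)
Definition mexp m (i : nat) : nat := nth 0%N (multinom_val m) i.

Lemma mexpE m (i : 'I_n) : mexp m i = m i.
Proof. by rewrite [RHS](mnm_nth 0). Qed.

Lemma mexp_out m i : (n <= i)%N -> mexp m i = 0%N.
Proof. by move=> ni; rewrite /mexp nth_default // size_tuple. Qed.

Lemma mexpD m1 m2 i : mexp (m1 + m2)%MM i = (mexp m1 i + mexp m2 i)%N.
Proof.
have [ni|in_] := leqP n i; first by rewrite !mexp_out.
by rewrite -[i]/(nat_of_ord (Ordinal in_)) !mexpE mnmDE.
Qed.

Definition window (i : nat) : 'X_{1..n} := [multinom (i <= j < i + 3) | j < n].

Lemma mexp_window i j :
  mexp (window i) j = ((i <= j < i + 3) && (j < n))%N :> nat.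
Proof.
have [nj|jn] := leqP n j; first by rewrite mexp_out ?andbF.
by rewrite -[j in LHS]/(nat_of_ord (Ordinal jn)) mexpE mnmE andbT.
Qed.

Lemma window_le i m : (i + 3 <= n)%N -> (window i <= m)%MM =
  [&& 0 < mexp m i, 0 < mexp m i.+1 & 0 < mexp m i.+2]%N.
Proof.
move=> i_n; apply/mnm_lepP/and3P => [h|[h0 h1 h2] j].
  have hh j : (i <= j < i + 3)%N -> (0 < mexp m j)%N.
    move=> ij; have jn : (j < n)%N by lia.
    by have := h (Ordinal jn); rewrite -!mexpE mexp_window ij jn.
  by split; apply: hh; lia.
rewrite -!mexpE mexp_window; case: (boolP (_ && _)) => //= /andP[ij _].
have : nat_of_ord j = i \/ nat_of_ord j = i.+1 \/ nat_of_ord j = i.+2 by lia.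
by case=> [|[|]] ->.
Qed.

(* The monomials of the path ideal on the first j variables. *)
Definition path_mnm (j : nat) m : bool :=
  has (fun i => (window i <= m)%MM) (iota 0 (j - 2)).

Lemma path_mnmP j m : (j <= n)%N ->
  reflect (exists i, [/\ (i + 3 <= j)%N, 0 < mexp m i, 0 < mexp m i.+1
                       & 0 < mexp m i.+2]%N)
    (path_mnm j m).
Proof.
move=> jn; apply: (iffP hasP) => [[i]|[i [ij h0 h1 h2]]].
  rewrite mem_iota => ij; rewrite window_le; last by lia.
  by case/and3P=> *; exists i; split=> //; lia.
exists i; first by rewrite mem_iota; lia.
by rewrite window_le; [rewrite h0 h1 h2|lia].
Qed.

Lemma path_mnm_closed j : mnm_closed (path_mnm j).
Proof.
move=> m m' /hasP[i ij im]; apply/hasP; exists i => //.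
by apply: lepm_trans im _; apply/mnm_lepP => l; rewrite mnmDE leq_addr.
Qed.

Lemma path_mnm_small j m : (j <= 2)%N -> path_mnm j m = false.
Proof. by rewrite /path_mnm => /eqP ->. Qed.

Lemma path_mnmS j m : (2 <= j)%N ->
  path_mnm j.+1 m = path_mnm j m || (window (j - 2) <= m)%MM.
Proof.
move=> j2; rewrite /path_mnm subSn // -addn1 iotaD has_cat /= orbF.
by rewrite add0n.
Qed.

(** Dividing out the window at [j - 3] turns the window at [j - 4] into the variable at [j - 4]. The
    other windows through [j - 4] become redundant, and the remaining ones lie in the first [j - 4]
    variables. *)
Lemma path_mnm_colon j m : (4 <= j <= n)%N ->
  path_mnm j.-1 (window (j - 3) + m)%MM =
  path_mnm (j - 4) m || (0 < mexp m (j - 4))%N.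
Proof.
move=> jn; apply/path_mnmP/orP => [|[i [ij]]|]; first by lia.
  rewrite !mexpD !mexp_window => h0 h1 h2.
  have [e|ne] := eqVneq (mexp m (j - 4)) 0%N; last by right; lia.
  left; apply/path_mnmP; first by lia.
  have ij4 : (i + 3 <= j - 4)%N.
    rewrite leqNgt; apply/negP => ij4.
    have : (i = j - 4 \/ i.+1 = j - 4 \/ i.+2 = j - 4)%N by lia.
    by case=> [|[|]] E; move: h0 h1 h2; rewrite E e; lia.
  by exists i; split=> //; lia.
case=> [/path_mnmP [|i [ij h0 h1 h2]]|h]; first by lia.
  by exists i; rewrite !mexpD; split; lia.
exists (j - 4)%N; rewrite !mexpD !mexp_window; split; lia.
Qed.

(** This is [j./2], except for [j] congruent to 2 modulo 4, where it is one less. *)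
Definition path_pd (j : nat) : nat := (j %/ 4 * 2 + (j %% 4 == 3))%N.

Lemma pd_lt_path j (W : ideal S) : (j <= n)%N ->
    (forall f, (f \in W) = monomials_in (path_mnm j) f) ->
  pd_lt (@projective S) (path_pd j).+1 (quotient_module W).
Proof.
elim/ltn_ind: j W => j IH W jn WE.
have [j2|j3] := leqP j 2.
  apply: (@pd_lt_le _ 1) => //; apply: pd_lt_free_quotient => f.
  rewrite WE => /monomials_inP f0; apply/mpolyP => m; rewrite mcoeff0 f0 //.
  by rewrite path_mnm_small.
have [W2 W2E] := monomial_ideal_ex k (@path_mnm_closed j.-1).
have WW2 f : f \in W <-> exists g, f - 'X_[window (j - 3)] * g \in W2.
  rewrite WE (@monomials_in_add _ _ (path_mnm j.-1) _ (window (j - 3))).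
    by split=> -[g gE]; exists g; move: gE; rewrite W2E.
  move=> m; have jS : j = j.-1.+1 by lia.
  rewrite {1}jS path_mnmS; last by lia.
  by congr (_ || (window _ <= _)%MM); lia.
have [j4|j_le3] := leqP 4 j; last first.
  have jE : j = 3%N by lia.
  have [W0 W0E] := monomial_ideal_ex k (@path_mnm_closed 0).
  (* For [j = 3] the ideal on two variables is zero, and so is its colon ideal [W0]. *)
  rewrite jE (_ : path_pd 3 = 1%N) //.
  apply: (pd_lt_colon (W1 := W0)) WW2 _ _ => [f| |].
  - rewrite W2E W0E; apply: monomials_in_colon => m.
    by rewrite !path_mnm_small // jE.
  - by apply: (IH 0%N) => //; lia.
  - by apply: pd_ltS; apply: (IH 2%N) => //; [lia|rewrite jE in W2E].
have [W4 W4E] := monomial_ideal_ex k (@path_mnm_closed (j - 4)).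
pose D1 m := path_mnm (j - 4) m || (0 < mexp m (j - 4))%N.
have [|W1 W1E] := @monomial_ideal_ex k n D1.
  move=> m m' /orP[h|h]; apply/orP; [left|right]; first exact: path_mnm_closed.
  by rewrite mexpD; lia.
have i_n : (j - 4 < n)%N by lia.
pose i : 'I_n := Ordinal i_n.
have U_le m : (U_(i) <= m)%MM = (0 < mexp m (j - 4))%N.
  by rewrite -[(j - 4)%N]/(nat_of_ord i) mexpE lep1mP lt0n.
have mexpU l : (l < j - 4)%N -> mexp U_(i)%MM l = 0%N.
  move=> l_j; have ln : (l < n)%N by lia.
  rewrite -[l]/(nat_of_ord (Ordinal ln)) mexpE mnm1E -val_eqE /=.
  by case: eqP => // e; move: l_j; rewrite -e ltnn.
(* Four variables cost two steps: one for the colon sequence and one for adjoining the variable at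
   [j - 4]. *)
have pdE : path_pd j = (path_pd (j - 4)).+2 by rewrite /path_pd; lia.
have pd1 : (path_pd j.-1 <= path_pd j)%N by rewrite /path_pd; lia.
apply: (pd_lt_colon (W1 := W1)) WW2 _ _.
- move=> f; rewrite W2E (W1E f); apply: monomials_in_colon => m.
  by rewrite path_mnm_colon ?j4.
- rewrite pdE; have h4 := IH (j - 4)%N _ W4 _ W4E.
  (* The variable does not occur in the generators of [W4], hence is regular modulo [W4], and the
     colon ideal is [W4] again. *)
  apply: (@pd_lt_colon _ _ _ W4 W4 W1 'X_[U_(i)]); last 2 first.
  + by apply: h4; lia.
  + by apply: pd_ltS; apply: h4; lia.
  + move=> f; rewrite !W4E; apply: monomials_in_colon => m.
    apply/path_mnmP/path_mnmP; [lia|lia| |] => -[l [lj h0 h1 h2]];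
      by exists l; move: h0 h1 h2; rewrite !mexpD !mexpU ?add0n; try split; lia.
  + move=> f; rewrite W1E (@monomials_in_add _ _ (path_mnm (j - 4)) _ U_(i)).
      by split=> -[g gE]; exists g; move: gE; rewrite W4E.
    by move=> m; rewrite U_le.
- apply: (@pd_lt_le _ (path_pd j.-1).+1) => //.
  by apply: (IH j.-1) => //; lia.
Qed.

End PathIdeal.

(** * Closure properties of ideals *)

Lemma in_ideal_genP (R : comNzRingType) m (f : 'I_m -> R) (x : R^o) :
  reflect (exists c : 'I_m -> R, x = \sum_(i < m) c i * f i)
    (x \in ideal_gen f).
Proof. exact: asboolP. Qed.

Lemma ideal_gen_mem (R : comNzRingType) m (f : 'I_m -> R) (a : R) i :
  a * f i \in ideal_gen f.
Proof.
apply/in_ideal_genP; exists (fun j => if j == i then a else 0).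
rewrite (bigD1 i) //= eqxx big1 ?addr0 // => j /negbTE ->.
by rewrite mul0r.
Qed.

Lemma ideal_sum (R : comNzRingType) (W : ideal R) (J : Type) (r : seq J)
    (P : pred J) (F : J -> R) :
  (forall i, P i -> F i \in W) -> \sum_(i <- r | P i) F i \in W.
Proof.
move=> FW; elim/big_rec: _ => [|i x Pi xW]; first exact: (@rpred0 _ W).
exact: (@rpredD _ W _ _ (FW i Pi) xW).
Qed.

Lemma ideal_mull (R : comNzRingType) (W : ideal R) (a x : R) :
  x \in W -> a * x \in W.
Proof. exact: (@rpredZ _ _ W). Qed.

(** * A minimal prime of the path ideal and its projective dimension *)

Section PathIdealDimension.
Variables (k : fieldType) (n : nat).
Local Notation S := {mpoly k[n]}.
Local Notation I := (path_ideal_line k n 3).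

Lemma path_ideal_genE (i : 'I_(n.+1 - 3)) :
  path_ideal_gen k i = 'X_[window n i].
Proof.
rewrite /path_ideal_gen mpolyXE_id big_mkcond; apply: eq_bigr => j _.
by rewrite mnmE; case: (_ && _); rewrite ?expr1 ?expr0.
Qed.

Lemma in_path_ideal (f : S) : (f \in I) = monomials_in (path_mnm n) f.
Proof.
apply/idP/idP => [/in_ideal_genP[c ->]|/allP fI].
  have [W WE] := monomial_ideal_ex k (@path_mnm_closed n n).
  rewrite -WE; apply: ideal_sum => i _.
  apply: ideal_mull; rewrite WE path_ideal_genE.
  rewrite /monomials_in msuppX /= andbT; apply/hasP; exists (nat_of_ord i).
    by rewrite mem_iota; have := ltn_ord i; lia.
  exact: lepm_refl.
rewrite [f]mpolyE big_seq.
apply: ideal_sum => m /fI /hasP[i].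
rewrite mem_iota => i_n im.
have in' : (i < n.+1 - 3)%N by lia.
rewrite -(submK im) mpolyXD scalerAl.
rewrite (_ : window n i = window n (Ordinal in')) // -path_ideal_genE.
exact: ideal_gen_mem.
Qed.

(* The variables X_i with i covered generate a minimal prime of the path ideal;
   the t-th of them is at position cover_pos t. *)
Definition covered (i : nat) : bool :=
  ((i %% 4 == 0) || (i %% 4 == 3))%N && (i./2 < n./2)%N.

Definition cover_pos (t : nat) : nat := (2 * t + odd t)%N.

Hypothesis hmod : n <> 2 %[mod 4].

(** For [n] congruent to 2 modulo 4, the last covered position [n - 2] would have no window that
    meets the cover in it alone. *)
Let n_mod4 : (n %% 4 != 2)%N. Proof. exact/eqP. Qed.

Lemma cover_posP t : (t < n./2)%N ->
  [/\ (cover_pos t < n)%N, covered (cover_pos t) & (cover_pos t)./2 = t].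
Proof. by rewrite /covered /cover_pos => tn; split; lia. Qed.

Definition cover_ord (t : 'I_(n./2)) : 'I_n :=
  Ordinal (let: And3 h _ _ := cover_posP (ltn_ord t) in h).

Lemma cover_ord_inj : injective cover_ord.
Proof.
move=> t1 t2 /(congr1 val) /= e; apply: val_inj => /=.
have [_ _ <-] := cover_posP (ltn_ord t1).
by have [_ _ <-] := cover_posP (ltn_ord t2); rewrite e.
Qed.

Lemma window_covered i : (i + 3 <= n)%N ->
  [|| covered i, covered i.+1 | covered i.+2].
Proof. by rewrite /covered => i_n; lia. Qed.

(* A window meeting the cover in cover_pos t only starts at 2 t - odd t. *)
Lemma cover_pos_window t : (t < n./2)%N ->
  exists i, [/\ (i + 3 <= n)%N, (i <= cover_pos t < i + 3)%N
    & forall j, (i <= j < i + 3)%N -> j != cover_pos t -> ~~ covered j].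
Proof.
move=> tn; exists (2 * t - odd t)%N; rewrite /cover_pos /covered.
by split=> [||j]; lia.
Qed.

Definition socle_mnm : 'X_{1..n} := [multinom ~~ covered i | i < n].

Lemma mexp_socle j : (j < n)%N -> mexp socle_mnm j = ~~ covered j :> nat.
Proof. by move=> jn; rewrite -[j]/(nat_of_ord (Ordinal jn)) mexpE mnmE. Qed.

Lemma socle_notin : 'X_[socle_mnm] \notin I.
Proof.
rewrite in_path_ideal /monomials_in msuppX /= andbT.
apply/negP => /path_mnmP [//|i [i_n]].
rewrite !mexp_socle; [|lia..].
by have := window_covered i_n; do 3!case: covered.
Qed.

(** The window whose only covered position is that of [t] divides this product. *)
Lemma socle_killed t : 'X_(cover_ord t) * 'X_[socle_mnm] \in I.
Proof.
rewrite in_path_ideal -mpolyXD /monomials_in msuppX /= andbT.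
apply/path_mnmP => //; have [i [i_n it hi]] := cover_pos_window (ltn_ord t).
have pos j : (i <= j < i + 3)%N ->
    (0 < mexp (U_(cover_ord t) + socle_mnm)%MM j)%N.
  move=> ij; have jn : (j < n)%N by lia.
  rewrite mexpD mexp_socle //.
  rewrite -[j in mexp _ j]/(nat_of_ord (Ordinal jn)) mexpE mnm1E -val_eqE /=.
  have [//|ne] := eqVneq; rewrite hi // eq_sym //.
by exists i; split=> //; apply: pos; lia.
Qed.

Lemma path_ideal_pd_lt m :
  pd_lt (@projective S) m (quotient_module I) -> (n./2 < m)%N.
Proof.
move=> pdI; rewrite ltnNge; apply/negP => m_d.
have [p [_ ker_p]] := cokernel_ex I.
have := socle_notin; apply/negP; rewrite negbK; apply/ker_p.
pose cs := [seq 'X_i : S | i <- [seq cover_ord t | t <- enum 'I_(n./2)]].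
apply: (@pd_lt_socle _ m cs).
- rewrite map_inj_uniq; first by rewrite (map_inj_uniq cover_ord_inj) enum_uniq.
  move=> i j /(congr1 (mcoeff U_(i))); rewrite !mcoeffXU eqxx.
  by case: eqP => // _ /eqP; rewrite oner_eq0.
- by rewrite size_map size_map size_enum_ord.
(* Division by the variables in the ring itself supplies the operators on every projective
   module. *)
- apply: sub_pd_lt pdI => P; apply: projective_div_ops.
  exact: div_ops_vars.
- move=> _ /mapP[_ /mapP[t _ ->] ->]; rewrite -linearZ; apply/ker_p.
  exact: socle_killed.
Qed.

Lemma path_ideal_pd : is_pd (quotient_module I) n./2.
Proof.
have pdE : path_pd n = n./2 by rewrite /path_pd; lia.
split=> [|s [P P0]].
  have := pd_lt_path (leqnn n) in_path_ideal; rewrite pdE.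
  by case/pd_lt_resolution => P P0; exists P => i /P0.
by rewrite -ltnS; apply/path_ideal_pd_lt/(resolution_pd_lt (P := P)).
Qed.

End PathIdealDimension.

(** * A dimension count bounding the number of parameters *)

Section ParameterCount.
Variables (k : fieldType) (d s N : nat) (h : 'I_s -> {mpoly k[d]}).
Local Notation S := {mpoly k[d]}.
Implicit Types (f g r : S) (m : 'X_{1..d}).

(** Membership in the [e]-th power of the irrelevant ideal. *)
Definition order_ge (e : nat) f := forall m, (mdeg m < e)%N -> f@_m = 0.

Lemma order_ge0 f : order_ge 0 f. Proof. by []. Qed.

Lemma order_geM e e' f g : order_ge e f -> order_ge e' g ->
  order_ge (e + e') (f * g).
Proof.
move=> fe ge' m; apply: contraTeq; rewrite -mcoeff_msupp -leqNgt.
move=> /msuppM_le /allpairsP[[m1 m2]] /= [m1f m2g ->].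
rewrite mdegD leq_add // leqNgt.
  by apply: contraL m1f => /fe; rewrite mcoeff_msupp => ->; rewrite eqxx.
by apply: contraL m2g => /ge'; rewrite mcoeff_msupp => ->; rewrite eqxx.
Qed.

Hypothesis h0 : forall j, (h j)@_0%MM = 0.
Hypothesis hX : forall i, 'X_i ^+ N \in ideal_gen h.

Definition hpow (a : {ffun 'I_s -> nat}) : S := \prod_(j < s) h j ^+ a j.

Lemma order_hpow (a : {ffun 'I_s -> nat}) : order_ge (\sum_j a j) (hpow a).
Proof.
rewrite /hpow; elim/big_rec2: _ => [|j e f _ fe]; first exact: order_ge0.
apply: order_geM fe; elim: (a j) => [|b IHb]; first exact: order_ge0.
rewrite exprS -add1n; apply: order_geM IHb => m.
by rewrite ltnS leqn0 mdeg_eq0 => /eqP ->.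
Qed.

(** By the pigeonhole principle some variable occurs with exponent at least [N]. *)
Lemma mem_high_monomial m : (d * N < mdeg m)%N -> 'X_[m] \in ideal_gen h.
Proof.
move=> dm; have [i im] : exists i, (N <= m i)%N.
  apply/existsP; apply: contraLR dm; rewrite negb_exists -leqNgt => /forallP mN.
  rewrite mdegE -[d in (_ <= d * _)%N]card_ord -sum_nat_const.
  by apply: leq_sum => i _; have := mN i; rewrite -ltnNge => /ltnW.
have iNm : (U_(i) *+ N <= m)%MM.
  apply/mnm_lepP => j; rewrite mulmnE mnm1E.
  by case: eqVneq => [<-|] //=; rewrite mul1n.
by rewrite -(submK iNm) mpolyXD -mpolyXn; apply: ideal_mull.
Qed.

Lemma low_decomposition r : exists l (b : 'I_s -> S),
  r = l + \sum_j b j * h j /\ forall m, (d * N < mdeg m)%N -> l@_m = 0.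
Proof.
pose low m := (mdeg m <= d * N)%N.
have : \sum_(m <- msupp r | ~~ low m) r@_m *: 'X_[m] \in ideal_gen h.
  apply: ideal_sum => m; rewrite -ltnNge => /mem_high_monomial mh.
  by rewrite -mul_mpolyC; apply: ideal_mull.
case/in_ideal_genP => b bE.
exists (\sum_(m <- msupp r | low m) r@_m *: 'X_[m]), b; split.
  by rewrite -bE {1}[r]mpolyE (bigID low).
move=> m; rewrite ltnNge => mN; rewrite raddf_sum big1 // => m' m'l.
rewrite /= mcoeffZ mcoeffX; case: eqP => [e|]; last by rewrite mulr0.
by move: mN; rewrite -e; rewrite /low in m'l; rewrite m'l.
Qed.

Variable T : nat.
Local Notation cols := #|{: 'X_{1..d < T}}|.
Local Notation gens := ('X_{1..d < (d * N).+1} * {ffun 'I_s -> 'I_T})%type.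

(** The coordinates of [f] modulo the [T]-th power of the irrelevant ideal. *)
Definition coeff_row f : 'rV[k]_cols := \row_(j < cols) f@_(bmnm (enum_val j)).

Lemma coeff_rowD f g : coeff_row (f + g) = coeff_row f + coeff_row g.
Proof. by apply/rowP => j; rewrite !mxE mcoeffD. Qed.

Lemma coeff_row0 : coeff_row 0 = 0.
Proof. by apply/rowP => j; rewrite !mxE mcoeff0. Qed.

Lemma coeff_rowZ c f : coeff_row (c *: f) = c *: coeff_row f.
Proof. by apply/rowP => j; rewrite !mxE mcoeffZ. Qed.

Definition nat_exponent (a : {ffun 'I_s -> 'I_T}) : {ffun 'I_s -> nat} :=
  [ffun j => nat_of_ord (a j)].

Definition gen_mx : 'M[k]_(#|{: gens}|, cols) :=
  \matrix_(i < #|{: gens}|)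
    coeff_row ('X_[(enum_val i).1] * hpow (nat_exponent (enum_val i).2)).

(** Induction on [t], a bound on how far the degree in the [h j] falls short of [T]. Decomposing [r]
    gives rows of [gen_mx] and terms with one more factor [h j]; once that degree reaches [T], a
    term vanishes in the quotient. *)
Lemma coeff_row_gen_sub (t : nat) (a : {ffun 'I_s -> nat}) r :
  (T <= t + \sum_j a j)%N -> (coeff_row (r * hpow a) <= gen_mx)%MS.
Proof.
elim: t a r => [|t IH] a r.
  rewrite add0n => Ta; rewrite (_ : coeff_row _ = 0) ?sub0mx //.
  apply/rowP => j; rewrite !mxE.
  apply: (order_geM (order_ge0 r) (@order_hpow a)).
  by rewrite add0n (leq_trans _ Ta) //; apply: (valP (enum_val j)).
move=> Ta; have [Ta'|aT] := leqP T (\sum_j a j).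
  exact/IH/(leq_trans Ta')/leq_addl.
have [l [b [-> l_low]]] := low_decomposition r.
rewrite mulrDl coeff_rowD addmx_sub //.
  rewrite [l]mpolyE mulr_suml big_seq.
  elim/big_rec: _ => [|m f ml IHf]; first by rewrite coeff_row0 sub0mx.
  rewrite coeff_rowD addmx_sub // -scalerAl coeff_rowZ scalemx_sub //.
  have mlow : (mdeg m < (d * N).+1)%N.
    rewrite ltnS leqNgt; apply: contraL ml => /l_low e.
    by rewrite mcoeff_msupp e eqxx.
  (* The total degree is still below [T], so [a] indexes a row of [gen_mx]. *)
  have aj j : (a j < T)%N.
    by apply: leq_ltn_trans aT; rewrite (bigD1 j) //= leq_addr.
  pose x : gens := (BMultinom mlow, [ffun j => Ordinal (aj j)]).
  have := row_sub (enum_rank x) gen_mx; rewrite rowK enum_rankK /=.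
  congr (coeff_row (_ * hpow _) <= _)%MS.
  by apply/ffunP => j; rewrite !ffunE.
rewrite mulr_suml; elim/big_rec: _ => [|j f _ IHf].
  by rewrite coeff_row0 sub0mx.
rewrite coeff_rowD addmx_sub //.
pose a' : {ffun 'I_s -> nat} := [ffun i => ((i == j) + a i)%N].
rewrite (_ : b j * h j * hpow a = b j * hpow a').
  apply: IH; rewrite (leq_trans Ta) // addSnnS leq_add2l.
  rewrite [leqRHS](eq_bigr (fun i => (i == j) + a i)%N) => [|i _]; last first.
    by rewrite ffunE.
  by rewrite big_split /= -add1n leq_add2r (bigD1 j) //= eqxx.
rewrite -mulrA; congr (_ * _); rewrite /hpow.
rewrite (bigD1 j) //= [RHS](bigD1 j) //= ffunE eqxx add1n exprS -mulrA.
congr (_ * (_ * _)); apply: eq_bigr => i /negbTE ij.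
by rewrite ffunE ij.
Qed.

(** The rows of [gen_mx] span all coordinates, since each monomial is covered by the case of zero
    exponents in the [h j]. Hence there are at least as many rows as columns. *)
Lemma card_low_monomials :
  (#|{: 'X_{1..d < T}}| <= #|{: 'X_{1..d < (d * N).+1}}| * T ^ s)%N.
Proof.
suff /eqP <- : row_full gen_mx.
  apply: leq_trans (rank_leq_row _) _.
  by rewrite card_prod card_ffun !card_ord.
rewrite -sub1mx; apply/row_subP => i.
have -> : row i 1%:M = coeff_row ('X_[enum_val i] * hpow [ffun=> 0%N]).
  apply/rowP => j; rewrite !mxE /hpow big1 => [|l _]; last by rewrite ffunE expr0.
  rewrite mulr1 mcoeffX; congr (_%:R); congr nat_of_bool.
  by rewrite (inj_eq val_inj) (inj_eq enum_val_inj).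
by apply: (@coeff_row_gen_sub T); rewrite leq_addr.
Qed.

End ParameterCount.

(** Only the cube of exponents below [a] is counted. *)
Lemma card_mnm_lt_ge d a : (a ^ d <= #|{: 'X_{1..d < (d * a).+1}}|)%N.
Proof.
have lt_mnm (x : {ffun 'I_d -> 'I_a}) :
    (mdeg [multinom nat_of_ord (x i) | i < d] < (d * a).+1)%N.
  rewrite ltnS mdegE -[d in (_ <= d * _)%N]card_ord -sum_nat_const.
  by apply: leq_sum => i _; rewrite mnmE ltnW.
rewrite -[X in (X ^ _)%N]card_ord -[X in (_ ^ X)%N]card_ord -card_ffun.
apply: (@leq_card _ _ (fun x => BMultinom (lt_mnm x))).
move=> x y /(congr1 val) /= /mnmP e; apply/ffunP => i; apply: val_inj.
by have := e i; rewrite !mnmE.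
Qed.

(* A case of Krull's height theorem, by comparing Hilbert functions: modulo the
   T-th power of the irrelevant ideal, the ring is spanned by the products of
   boundedly many monomials with the at most T^s monomials in the h j. *)
Lemma leq_parameters (k : fieldType) (d s N : nat) (h : 'I_s -> {mpoly k[d]}) :
    (forall j, (h j)@_0%MM = 0) -> (forall i, 'X_i ^+ N \in ideal_gen h) ->
  (d <= s)%N.
Proof.
move=> h0 hX; rewrite leqNgt; apply/negP => s_d.
pose K := #|{: 'X_{1..d < (d * N).+1}}|.
(* Since [(d * a).+1 <= d.+1 * a], the count gives [a ^ d <= K * d.+1 ^ s * a ^ s]. As [a] exceeds
   [K * d.+1 ^ s], the right side is below [a ^ s.+1], hence below [a ^ d]. *)
pose a := (K * d.+1 ^ s).+1.
have := leq_trans (card_mnm_lt_ge d a) (card_low_monomials h0 hX (d * a).+1).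
apply/negP; rewrite -ltnNge -/K.
apply: (@leq_ltn_trans (K * (d.+1 * a) ^ s)).
  by case: (s) => [|s']; rewrite ?expn0 // leq_mul2l leq_exp2r ?orbT //; lia.
rewrite expnMn mulnA; apply: (@leq_trans (a ^ s.+1)); last exact: leq_pexp2l.
by rewrite expnS ltn_pmul2r ?expn_gt0.
Qed.

(** * Radicals of ideals *)

Section Radical.
Variable R : comNzRingType.
Implicit Types (I : ideal R) (a b x : R).

Lemma sub_radical I x : x \in I -> radical I x.
Proof. by exists 1%N. Qed.

Lemma radical_exp I x m : radical I (x ^+ m) -> radical I x.
Proof. by case=> m' xm; exists (m * m')%N; rewrite exprM. Qed.

Lemma radical_mul I a x : radical I x -> radical I (a * x).
Proof. by case=> m xm; exists m; rewrite exprMn; apply: ideal_mull. Qed.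

Lemma radical_add I a b : radical I a -> radical I b -> radical I (a + b).
Proof.
move=> [m am] [m' bm']; exists (m + m')%N; rewrite exprDn.
apply: ideal_sum => i _; rewrite -mulr_natl; apply: ideal_mull.
have [m'i|im'] := leqP m' i.
  by rewrite -(subnK m'i) exprD mulrA; apply: ideal_mull.
rewrite (_ : m + m' - i = m' - i + m)%N; last by lia.
by rewrite exprD mulrAC; apply: ideal_mull.
Qed.

Lemma radical_sum I m (F : 'I_m -> R) :
  (forall i, radical I (F i)) -> radical I (\sum_i F i).
Proof.
move=> IF; elim/big_rec: _ => [|i x _ xI]; last exact: radical_add.
by apply: sub_radical; apply: (@rpred0 _ I).
Qed.

(** The two-term case of the Schmitt-Vogel lemma, from [a ^+ 2 = a * (a + b) - a * b]. *)
Lemma schmitt_vogel I a b :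
  radical I (a + b) -> radical I (a * b) -> radical I a /\ radical I b.
Proof.
move=> ab_s ab_p.
have aI : radical I a.
  apply: (@radical_exp _ _ 2); rewrite (_ : a ^+ 2 = a * (a + b) + -1 * (a * b)).
    by apply: radical_add; apply: radical_mul.
  by ring.
split=> //; have := radical_add ab_s (radical_mul (-1) aI).
by rewrite (_ : a + b + -1 * a = b) //; ring.
Qed.

End Radical.

(** * Arithmetical rank of the path ideal *)

Section PathIdealAra.
Variables (k : fieldType) (n : nat).
Local Notation S := {mpoly k[n]}.
Local Notation I := (path_ideal_line k n 3).
Local Notation d := n./2.

Definition path_gen (i : nat) : S :=
  if (i + 3 <= n)%N then 'X_[window n i] else 0.

Lemma path_gen_in i : path_gen i \in I.
Proof.
rewrite in_path_ideal /path_gen; case: leqP => i_n; last first.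
  by apply/monomials_inP => m _; rewrite mcoeff0.
rewrite /monomials_in msuppX /= andbT; apply/hasP; exists i; last exact: lepm_refl.
by rewrite mem_iota; lia.
Qed.

(** The windows at [i] and [i'] together contain the one at [i.+1]. If the window at [i'] does not
    fit, the product is zero. *)
Lemma path_gen_dvd i i' : (i.+1 < i' <= i + 3)%N ->
  exists c, path_gen i * path_gen i' = c * path_gen i.+1.
Proof.
move=> ii'; rewrite /path_gen.
have [i'n|] := leqP (i' + 3) n; last by exists 0; rewrite mulr0 mul0r.
have -> : (i + 3 <= n)%N by lia.
have -> : (i.+1 + 3 <= n)%N by lia.
rewrite -mpolyXD.
have le_w : (window n i.+1 <= window n i + window n i')%MM.
  apply/mnm_lepP => j; rewrite !mnmE; lia.
by exists 'X_[window n i + window n i' - window n i.+1]; rewrite -mpolyXD submK.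
Qed.

Definition even_part (j : nat) : S :=
  if j is j'.+1 then path_gen (2 * j') else 0.
(** At the last index the odd window would not fit. The even window at [2 * j] takes its place; it
    fits exactly when [n] is odd and is zero otherwise. *)
Definition odd_part (j : nat) : S :=
  if (j.+1 < d)%N then path_gen (2 * j).+1 else path_gen (2 * j).
Definition ara_gen (j : 'I_d) : S := even_part j + odd_part j.

(** Induction on [j]: the product of the two parts at [j.+1] is a multiple of the odd part at [j],
    already in the radical, so [schmitt_vogel] separates them. At 0 the even part is zero. *)
Lemma ara_parts j : (j < d)%N ->
  radical (ideal_gen ara_gen) (even_part j) /\
  radical (ideal_gen ara_gen) (odd_part j).
Proof.
elim: j => [|j IH] jd; apply: schmitt_vogel.
- apply: sub_radical; rewrite -[_ + _]mul1r.
  exact: (ideal_gen_mem ara_gen 1 (Ordinal jd)).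
- by rewrite mul0r; apply: sub_radical; apply: (@rpred0 _ (ideal_gen ara_gen)).
- apply: sub_radical; rewrite -[_ + _]mul1r.
  exact: (ideal_gen_mem ara_gen 1 (Ordinal jd)).
have [_] := IH (ltnW jd); rewrite /odd_part jd => gI.
have [c ->] : exists c, even_part j.+1 *
    (if (j.+2 < d)%N then path_gen (2 * j.+1).+1 else path_gen (2 * j.+1)) =
    c * path_gen (2 * j).+1.
  by case: ifP => _; apply: path_gen_dvd; lia.
exact: radical_mul.
Qed.

Lemma radical_path_gen i : radical (ideal_gen ara_gen) (path_gen i).
Proof.
have [i_n|i_n] := leqP (i + 3) n; last first.
  rewrite /path_gen leqNgt i_n /=; apply: sub_radical.
  exact: (@rpred0 _ (ideal_gen ara_gen)).
have [i_odd|i_even] := boolP (odd i).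
  have jd : (i./2 < d)%N by lia.
  have [_] := ara_parts jd; rewrite /odd_part ifT; last by lia.
  by rewrite (_ : (2 * i./2).+1 = i) //; lia.
have jd : (i./2 < d)%N by lia.
have iE : (2 * i./2 = i)%N by lia.
(* An even window is the even part of the next generator, or the replaced odd part of the last
   one. *)
have [jd'|jd'] := ltnP i./2.+1 d.
  by have [+ _] := ara_parts jd'; rewrite /= iE.
by have [_] := ara_parts jd; rewrite /odd_part ltnNge jd' /= iE.
Qed.

Lemma radical_ara_gen : radical I = radical (ideal_gen ara_gen).
Proof.
apply/funext => x; apply/propext; split=> -[m xm]; last first.
  exists m; case/in_ideal_genP: xm => c ->.
  apply: ideal_sum => j _; apply: ideal_mull.
  apply: (@rpredD _ I); last by rewrite /odd_part; case: ifP; rewrite path_gen_in.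
  by case: (nat_of_ord j) => [|j'] /=; [exact: (@rpred0 _ I)|exact: path_gen_in].
apply: (@radical_exp _ _ _ m); case/in_ideal_genP: xm => c ->.
apply: radical_sum => i; apply: radical_mul.
have := radical_path_gen i; rewrite /path_gen ifT ?path_ideal_genE //.
by have := ltn_ord i; lia.
Qed.

Hypothesis hmod : n <> 2 %[mod 4].

(** The product has at most one factor: it is ['X_t] at position [cover_pos t] and 1 at uncovered
    positions. *)
Definition cover_value (i : 'I_n) : {mpoly k[d]} :=
  \prod_(t < d | cover_pos t == i) 'X_t.

Lemma covered_pos i : covered n i -> cover_pos i./2 = i.
Proof. by rewrite /covered /cover_pos; lia. Qed.

Lemma cover_value_pos t : cover_value (cover_ord hmod t) = 'X_t.
Proof.
rewrite /cover_value (big_pred1 t) // => t' /=.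
apply/eqP/eqP => [e|->] //; apply: (@cover_ord_inj _ hmod); exact: val_inj.
Qed.

Lemma cover_value_uncovered (i : 'I_n) : ~~ covered n i -> cover_value i = 1.
Proof.
move=> iC; rewrite /cover_value big_pred0 // => t; apply: contraNF iC => /eqP <-.
by have [] := cover_posP hmod (ltn_ord t).
Qed.

Definition specialize : {rmorphism S -> {mpoly k[d]}} :=
  comp_mpoly [tuple cover_value i | i < n].

Lemma specialize_window i :
  specialize 'X_[window n i] = \prod_(j < n | (i <= j < i + 3)%N) cover_value j.
Proof.
rewrite /specialize /= comp_mpolyX [RHS]big_mkcond; apply: eq_bigr => j _.
by rewrite tnth_mktuple mnmE; case: (_ && _); rewrite ?expr1 ?expr0.
Qed.

(** Every window meets the cover, so its image is a multiple of a variable. *)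
Lemma specialize_mem f : f \in I -> (specialize f)@_0%MM = 0.
Proof.
case/in_ideal_genP => c ->; rewrite (rmorph_sum specialize) raddf_sum big1 // => i _ /=.
have i_n : (i + 3 <= n)%N by have := ltn_ord i; lia.
have [j [ij jn jC]] : exists j, [/\ (i <= j < i + 3)%N, (j < n)%N & covered n j].
  have := window_covered hmod i_n.
  case/or3P => h; [exists i|exists i.+1|exists i.+2]; split=> //; lia.
have jd : (j./2 < d)%N by case/andP: jC.
rewrite (rmorphM specialize) path_ideal_genE specialize_window (bigD1 (Ordinal jn)) //=.
rewrite (_ : Ordinal jn = cover_ord hmod (Ordinal jd)); last first.
  by apply: val_inj; rewrite /= covered_pos.
rewrite cover_value_pos mulrCA mcoeffXM_eq0 //.
by rewrite lep1mP mnm0E.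
Qed.

Lemma path_ideal_ara_ge s (f : 'I_s -> S) :
  radical I = radical (ideal_gen f) -> (d <= s)%N.
Proof.
move=> radE; pose h j := specialize (f j).
have h_mem g : g \in ideal_gen f -> specialize g \in ideal_gen h.
  case/in_ideal_genP => c ->; rewrite (rmorph_sum specialize); apply: ideal_sum => j _.
  by rewrite (rmorphM specialize); apply: ideal_gen_mem.
have Xh t : exists N, 'X_t ^+ N \in ideal_gen h.
  (* The window that meets the cover only in the position of [t] specializes to ['X_t]. *)
  have [i [i_n ct hi]] := cover_pos_window hmod (ltn_ord t).
  have [N /h_mem] : radical (ideal_gen f) (path_gen i).
    by rewrite -radE; apply/sub_radical/path_gen_in.
  rewrite /path_gen i_n (rmorphXn specialize) specialize_window.
  rewrite (bigD1 (cover_ord hmod t)) //= cover_value_pos big1 => [|j /andP[ij jt]].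
    by rewrite mulr1; exists N.
  by apply/cover_value_uncovered/hi.
have [N XN] := choice Xh.
(* The sum of the exponents [N t] serves all variables at once. *)
apply: (@leq_parameters k d s (\sum_t N t) h) => [j|t]; last first.
  by rewrite (bigD1 t) //= addnC exprD; apply/ideal_mull/XN.
have [m fm] : radical I (f j).
  by rewrite radE; apply: sub_radical; rewrite -[f j]mul1r ideal_gen_mem.
(* The constant term is a ring morphism to a field, so it vanishes on [h j] once it does on a
   power. *)
have := specialize_mem fm; rewrite (rmorphXn specialize) -/(h j) rmorphXn /=.
by move/eqP; rewrite expf_eq0 => /andP[_ /eqP].
Qed.

Lemma path_ideal_ara : is_ara I d.
Proof.
split; first by exists ara_gen; apply: radical_ara_gen.
by move=> s [f /path_ideal_ara_ge].
Qed.

End PathIdealAra.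

Local Close Scope ring_scope.

Theorem theorem4p5 (k : fieldType) (n : nat)
    (hn : (3 <= n)%N) (hmod : n <> 2 %[mod 4]) :
  exists d : nat,
    is_ara (path_ideal_line k n 3) d /\
    is_pd (quotient_module (path_ideal_line k n 3)) d.
Proof.
by exists n./2; split; [exact: path_ideal_ara|exact: path_ideal_pd].
Qed.
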